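(* Let $\mathcal{C} = (S_{\mathcal C}, \Sigma_{\mathcal C}, \mathit{next}_{\mathcal C}, \mathit{leak}_{\mathcal C})$ and $\mathcal{H} = (S_{\mathcal H}, \Sigma_{\mathcal H}, \mathit{next}_{\mathcal H}, \mathit{leak}_{\mathcal H})$ be two transition systems, and let $s_1, s_2 \in S_{\mathcal C}$ and $h_1, h_2 \in S_{\mathcal H}$. Then the guarded quintuple with empty hypothesis satisfies $$\mathsf{Grd}(\emptyset; s_1, s_2, h_1, h_2) \iff \bigl( [\![ s_1 ]\!]_{\mathcal C} = [\![ s_2 ]\!]_{\mathcal C} \implies [\![ h_1 ]\!]_{\mathcal H} = [\![ h_2 ]\!]_{\mathcal H} \bigr).$$
   Context: A transition system is a tuple $\mathcal T = (S, \Sigma, \mathit{next}, \mathit{leak})$, where $S$ is a set of states, $\Sigma$ is a set of observations, $\mathit{next} : S \to S$ is a transition function and $\mathit{leak} : S \to \Sigma$ is a leakage function. For $s \in S$, the infinite leakage trace $[\![ s ]\!]_{\mathcal T} \in \Sigma^\omega$ is the sequence $\mathit{leak}(s)\ \mathit{leak}(\mathit{next}(s))\ \mathit{leak}(\mathit{next}^2(s)) \ldots$, i.e. its $n$-th element is $\mathit{leak}(\mathit{next}^n(s))$. For a monotone function $F$ on the powerset of a set, $\nu X.\,F(X)$ denotes its greatest fixpoint and $\mu X.\,F(X)$ its least fixpoint. For $R_1 \subseteq S_{\mathcal C} \times S_{\mathcal C} \times S_{\mathcal H} \times S_{\mathcal H}$ define $\mathtt{rbisimF}(R_1) = \mu R_2.\,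 \Psi(R_1,R_2)$, where $\Psi(R_1, R_2)$ is the union of the three sets $\{ (s_1, s_2, h_1, h_2) \mid \mathit{leak}_{\mathcal C}(s_1) \neq \mathit{leak}_{\mathcal C}(s_2) \}$, $\{ (s_1, s_2, h_1, h_2) \mid (\mathit{next}_{\mathcal C}(s_1), \mathit{next}_{\mathcal C}(s_2), h_1, h_2) \in R_2 \}$, $\{ (s_1, s_2, h_1, h_2) \mid \mathit{leak}_{\mathcal H}(h_1) = \mathit{leak}_{\mathcal H}(h_2) \wedge (s_1, s_2, \mathit{next}_{\mathcal H}(h_1), \mathit{next}_{\mathcal H}(h_2)) \in R_1 \}$. Let $F = \mathtt{rbisimF}$ and, for $R \subseteq S_{\mathcal C} \times S_{\mathcal C} \times S_{\mathcal H} \times S_{\mathcal H}$, let $G_F(R) = \nu X.\, F(X \cup R)$. The guarded quintuple is defined by $\mathsf{Grd}(R; s_1,s_2,h_1,h_2) :\iff (s_1, s_2, h_1, h_2) \in G_F(R)$. (The paper writes it with a solid box around $R$.) *)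

(* Defs.v *)
From mathcomp Require Import all_boot.
From mathcomp Require Import boolp classical_sets.

Set Implicit Arguments.
Unset Strict Implicit.
Unset Printing Implicit Defensive.

Local Open Scope classical_set_scope.

Record transition_system := TransitionSystem {
  state : Type;
  obs : Type;
  next : state -> state;
  leak : state -> obs
}.

(* Sigma^omega is rendered as nat -> Sigma. *)
Definition trace (T : transition_system) (s : state T) : nat -> obs T :=
  fun n => leak (iter n (@next T) s).

Definition monotone_set (U : Type) (F : set U -> set U) : Prop :=
  forall X Y : set U, X `<=` Y -> F X `<=` F Y.

(* Least and greatest fixpoints, in Knaster-Tarski form; [lfpP] and [gfpP]
   show that for monotone F they are the least and greatest solutions of
   F X = X.  For other F the values carry no meaning. *)
Definition lfp (U : Type) (F : set U -> set U) : set U :=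
  \bigcap_(X in [set X | F X `<=` X]) X.

Definition gfp (U : Type) (F : set U -> set U) : set U :=
  \bigcup_(X in [set X | X `<=` F X]) X.

Lemma lfpP (U : Type) (F : set U -> set U) : monotone_set F ->
  F (lfp F) = lfp F /\ forall X, F X = X -> lfp F `<=` X.
Proof.
move=> mF.
have pre : F (lfp F) `<=` lfp F.
  by move=> x Fx X FX; apply: (FX); apply: (mF) Fx => y; apply.
split=> [|X FX x]; last by apply; rewrite /= FX.
by apply/seteqP; split=> // x; apply; apply: mF.
Qed.

Lemma gfpP (U : Type) (F : set U -> set U) : monotone_set F ->
  F (gfp F) = gfp F /\ forall X, F X = X -> X `<=` gfp F.
Proof.
move=> mF.
have post : gfp F `<=` F (gfp F).
  by move=> x [X FX Xx]; apply: (mF X); [move=> y Xy; exists X | apply: FX].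
split=> [|X FX x Xx]; last by exists X => //=; rewrite FX.
by apply/seteqP; split=> // x Fx; exists (F (gfp F)) => //; apply: mF.
Qed.

Section RelativeBisimulation.
Variables C H : transition_system.

Definition quad : Type := (state C * state C * state H * state H)%type.

Definition rbisim_step (R1 R2 : set quad) : set quad :=
  [set q | let: (s1, s2, h1, h2) := q in leak s1 <> leak s2] `|`
  [set q | let: (s1, s2, h1, h2) := q in R2 (next s1, next s2, h1, h2)] `|`
  [set q | let: (s1, s2, h1, h2) := q in
     leak h1 = leak h2 /\ R1 (s1, s2, next h1, next h2)].

Definition rbisimF (R1 : set quad) : set quad :=
  lfp (fun R2 => rbisim_step R1 R2).

End RelativeBisimulation.

Definition guarded_gfp (U : Type) (F : set U -> set U) (R : set U) : set U :=
  gfp (fun X => F (X `|` R)).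

Definition Grd (C H : transition_system) (R : set (quad C H))
    (s1 s2 : state C) (h1 h2 : state H) : Prop :=
  guarded_gfp (@rbisimF C H) R (s1, s2, h1, h2).

Lemma rbisim_step_monotone (C H : transition_system) (R1 : set (quad C H)) :
  monotone_set (rbisim_step R1).
Proof.
move=> X Y XY [[[s1 s2] h1] h2] [[]|]; first by left; left.
- by move=> Xq; left; right; apply: XY.
- by right.
Qed.

Lemma rbisimF_monotone (C H : transition_system) : monotone_set (@rbisimF C H).
Proof.
move=> X Y XY q Fq R2 R2Y; apply: Fq => -[[[s1 s2] h1] h2] q2.
apply: R2Y; case: q2 => [[]|[eh Xq]]; first by left; left.
- by left; right.
- by right; split=> //; apply: XY.
Qed.

Lemma guarded_monotone (U : Type) (F : set U -> set U) (R : set U) :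
  monotone_set F -> monotone_set (fun X => F (X `|` R)).
Proof.
by move=> mF X Y XY; apply: mF => x []; [move/XY; left | right].
Qed.

(* Main.v *)
(** A quadruple whose left traces differ lies in the inner least fixpoint after
    finitely many left steps, with no right step; a quadruple whose left traces
    agree can never use the first clause of the step, so the least fixpoint forces
    a right step after finitely many left ones, and one right step per unfolding of
    the outer greatest fixpoint compares the whole right traces. *)
Require Import Defs.
From mathcomp Require Import all_boot.
From mathcomp Require Import boolp classical_sets.

Local Open Scope classical_set_scope.

Lemma trace_next (T : transition_system) (s : state T) n :
  trace (Defs.next s) n = trace s n.+1.
Proof. by rewrite /trace iterSr. Qed.

Lemma eq_trace_next (T : transition_system) (s1 s2 : state T) :
  trace s1 = trace s2 -> trace (Defs.next s1) = trace (Defs.next s2).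
Proof. by move=> e; apply/funext => n; rewrite !trace_next e. Qed.

Section RelativeBisimulation.
Variables C H : transition_system.
Implicit Types (R : set (quad C H)) (s : state C) (h : state H).

Lemma rbisimF_closed R : rbisim_step R (rbisimF R) `<=` rbisimF R.
Proof. by have [-> _] := lfpP (@rbisim_step_monotone C H R). Qed.

Lemma rbisimF_of_trace_neq R n s1 s2 h1 h2 :
  trace s1 n <> trace s2 n -> rbisimF R (s1, s2, h1, h2).
Proof.
elim: n s1 s2 => [|n IHn] s1 s2 ne; apply: rbisimF_closed; left; first by left.
by right; apply: IHn; rewrite !trace_next.
Qed.

(** [t1] and [t2] are the left states at which the right step fires. Their distance from [s1] and
    [s2] is forgotten: equality of their traces is all that the next round needs. *)
Lemma rbisimF_eq_trace {R s1 s2 h1 h2} :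
  rbisimF R (s1, s2, h1, h2) -> trace s1 = trace s2 ->
  leak h1 = leak h2 /\
  exists t1 t2, trace t1 = trace t2 /\ R (t1, t2, Defs.next h1, Defs.next h2).
Proof.
pose P : set (quad C H) := [set q | let: (s1, s2, h1, h2) := q in
  trace s1 = trace s2 -> leak h1 = leak h2 /\
  exists t1 t2, trace t1 = trace t2 /\ R (t1, t2, Defs.next h1, Defs.next h2)].
(* Least-fixpoint induction: the intersection is instantiated at [P], leaving its closure under the
   step. *)
move/(_ P); apply=> -[[[{}s1 {}s2] {}h1] {}h2] [[ne|Pn]|[eh Rn]] /= e.
- by have := congr1 (@^~ 0) e.
- exact/Pn/eq_trace_next.
- by split=> //; exists s1, s2.
Qed.

Lemma postfixed_eq_trace {R s1 s2 h1 h2} :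
  R `<=` rbisimF R -> R (s1, s2, h1, h2) ->
  trace s1 = trace s2 -> trace h1 = trace h2.
Proof.
move=> RF Rq es; apply/funext => n.
elim: n s1 s2 h1 h2 Rq es => [|n IHn] s1 s2 h1 h2 /RF Fq es;
  have [eh [t1 [t2 [et Rt]]]] := rbisimF_eq_trace Fq es; first exact: eh.
by rewrite -!trace_next; apply: IHn Rt et.
Qed.

Lemma eq_trace_postfixed :
  let R : set (quad C H) := [set q | let: (s1, s2, h1, h2) := q in
    trace s1 = trace s2 -> trace h1 = trace h2] in
  R `<=` rbisimF R.
Proof.
move=> R [[[s1 s2] h1] h2] Rq.
(* With equal left traces the right step is taken at once, without any left step. *)
have [es|nes] := pselect (trace s1 = trace s2).
  apply: rbisimF_closed; right; have eh := Rq es; split.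
    exact: (congr1 (@^~ 0) eh).
  by move=> _; apply: eq_trace_next.
have [n] : exists n, trace s1 n <> trace s2 n.
  by apply/existsNP => e; apply/nes/funext.
exact: rbisimF_of_trace_neq.
Qed.

End RelativeBisimulation.

Theorem theorem16 (C H : transition_system)
    (s1 s2 : state C) (h1 h2 : state H) :
  Grd set0 s1 s2 h1 h2 <-> (trace s1 = trace s2 -> trace h1 = trace h2).
Proof.
rewrite /Grd /guarded_gfp.
(* The outer union now ranges over the post-fixed points of [rbisimF] itself. *)
under [X in gfp X]eq_fun do rewrite setU0.
split=> [[R RF Rq]|eq_tr]; first exact: postfixed_eq_trace RF Rq.
by eexists; first exact: eq_trace_postfixed.
Qed.
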